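(* Let $B,\bar B$ be real or complex vector spaces, $L(\varepsilon)=\sum_{i=0}^\infty\varepsilon^iL_i$ a formal power series with $L_i\in L(B,\bar B)$, $L(\varepsilon)\not\equiv0$, and let $k\ge0$. Assume that $L(\varepsilon)$ stabilizes at $k$, and run the recursion of the context with some choice of complements. Define the formal power series $$\phi(\varepsilon)=I_B+\sum_{i=1}^\infty\varepsilon^iM_{k+1,k+1+i}$$ with coefficients in $L(B,B)$. (i) By Cauchy product, $$S(\varepsilon):=L(\varepsilon)\cdot\phi(\varepsilon)=S_1+\varepsilon S_2+\cdots+\varepsilon^kS_{k+1}+\sum_{l=2}^\infty\varepsilon^{k+l-1}S_{k+l},$$ where for $i=1,\dots,k+1$ $$S_i(N_0^c+\cdots+N_{i-1}^c)\subset R_{i-1}^c,\qquad S_i(N_i^c)=R_i,\qquad S_i(N_i)=\{0\},$$ and for all $l\ge2$ $$R[S_{k+l}]\subset R_{k+1}^c,\qquad S_{k+l}(N_{k+1})=\{0\}.$$ In particular $S_i(N_{k+1})=\{0\}$ for all $i\ge1$. (ii) There exists a formal power series $\psi(\varepsilon)=I_{\bar B}+\sum_{i=1}^\infty\varepsilon^i\psi_i$ with $\psi_i\in L(\bar B,\bar B)$ such that $$S(\varepsilon)=\psi(\varepsilon)\cdot\Delta(\varepsilon),\qquad \Delta(\varepsilon):=S_1P_1+\varepsilon S_2P_2+\cdots+\varepsilon^kS_{k+1}P_{k+1},$$ where $P_1,\dots,P_{k+1}$ are the projections onto $N_1^c,\dots,N_{k+1}^c$ defined by the decomposition $B=N_1^c\oplus\cdots\oplus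 N_{k+1}^c\oplus N_{k+1}$.
   Context: $L(X,Y)$ denotes the linear maps from $X$ to $Y$; $N[T]$ and $R[T]$ are the kernel and range of $T$; $I_X$ is the identity. Formal power series in $\varepsilon$ are multiplied by the Cauchy product. Stabilization. For $k\ge1$ let $\Delta^k:B^k\to\bar B^k$ be the upper triangular block Toeplitz operator with $(i,j)$ entry $L_{j-i}$ for $j\ge i$ and $0$ otherwise, so that $\Delta^k(b_{k-1},\dots,b_0)^T=0$ iff $\sum_{i+j=m}L_ib_j=0$ for $m=0,\dots,k-1$. For $b_0\in B$ put $\mathrm{rank}(b_0)=0$ if $b_0\notin N[L_0]$, and otherwise $\mathrm{rank}(b_0)=\sup\{k\ge1\mid\exists (b_{k-1},\dots,b_0)\in B^k:\ \Delta^k(b_{k-1},\dots,b_0)^T=0\}\in\mathbb{N}\cup\{\infty\}$. $L(\varepsilon)$ stabilizes at $k\ge0$ if $\mathrm{rank}(b_0)\in\{0,\dots,k\}\cup\{\infty\}$ for all $b_0\in B$ and there exists $b_0$ with $\mathrm{rank}(b_0)=k$. Recursion. Put $N_0:=B$, $N_0^c:=\{0\}$, $R_0:=\{0\}$, $R_0^c:=\bar B$, $\bar S_1:=S_1:=L_0$, $E_{1,1}:=M_{1,1}:=I_B$. At each stage $j\ge1$, given $S_j\in L(B,R_{j-1}^c)$, set $N_j:=\{n\in N_{j-1}\mid S_jn=0\}$, $R_j:=S_j(N_{j-1})$ and choose algebraic direct complements $N_{j-1}=N_j^c\oplus N_j$, $R_{j-1}^c=R_j\oplus R_j^c$. Then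 $B=N_1^c\oplus\cdots\oplus N_j^c\oplus N_j$ and $\bar B=R_1\oplus\cdots\oplus R_j\oplus R_j^c$; $\mathcal P_j$ denotes the projection of $\bar B$ onto $R_j$ defined by the latter decomposition, and $S_j^{-1}:R_j\to N_j^c$ denotes the inverse of the bijection $S_j|_{N_j^c}:N_j^c\to R_j$. At stage $j\ge2$, the operators are defined by $$\bar S_j:=\sum_{i=1}^{j-1}L_iM_{i,j-1},\qquad S_j:=(I_{\bar B}-\mathcal P_1-\cdots-\mathcal P_{j-1})\bar S_j,$$ $$E_{j,j}:=I_B,\qquad E_{i,j}:=-S_i^{-1}\mathcal P_i\sum_{\nu=i+1}^{j}\bar S_\nu E_{\nu,j}\quad (i=j-1,\dots,1),$$ $$M_{1,j}:=E_{1,j},\qquad M_{i,j}:=\sum_{\nu=i}^{j}M_{i-1,\nu-1}E_{\nu,j}\quad(i=2,\dots,j).$$ (So $M_{j,j}=I_B$.) The recursion is continued for all $j$; the complements are the same choice throughout. *)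

(* Defs.v *)
From HB Require Import structures.
From mathcomp Require Import all_boot all_order all_algebra.
From mathcomp Require Import complex.
From mathcomp Require Import boolp classical_sets functions.
From mathcomp Require Import reals constructive_ereal ereal.

Set Implicit Arguments.
Unset Strict Implicit.
Unset Printing Implicit Defensive.

Import Order.TTheory GRing.Theory Num.Theory.

Local Open Scope classical_set_scope.
Local Open Scope ring_scope.

Definition real_or_complex (R : realType) (K : fieldType) : Prop :=
  K = (R : fieldType) \/ K = (R[i] : fieldType).

Section LinearSets.
Variables (K : fieldType) (V : lmodType K).

(* A = C (+) D, an algebraic direct sum of linear subspaces. *)
Definition direct_sum (A C D : set V) : Prop :=
  [/\ submod_closed (mem C), submod_closed (mem D),
      A = [set c + d | c in C & d in D] & C `&` D = [set 0]].

(* A_0 + ... + A_(n-1) *)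
Definition set_sum (n : nat) (A : nat -> set V) : set V :=
  [set x | exists2 a : nat -> V,
     forall m, (m < n)%N -> A m (a m) & x = \sum_(0 <= m < n) a m].

(* The projection of V = A_1 (+) ... (+) A_n (+) C onto A_i; the default value
   of xget is irrelevant whenever this is a direct decomposition of V. *)
Definition dsum_proj (n : nat) (A : nat -> set V) (C : set V) (i : nat)
    (x : V) : V :=
  xget 0 [set y | exists (a : nat -> V) (c : V),
    [/\ forall m, (1 <= m <= n)%N -> A m (a m), C c,
        x = \sum_(1 <= m < n.+1) a m + c & y = a i]].

End LinearSets.

(* The inverse of f restricted to A, meaningful on f(A) when f is injective
   on A. *)
Definition inv_on (K : fieldType) (U V : lmodType K) (A : set U) (f : U -> V)
    (y : V) : U :=
  xget 0 [set x | A x /\ f x = y].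

(* A formal power series is the sequence of its coefficients. *)
Definition cauchy_prod (K : fieldType) (U V W : lmodType K)
    (F : nat -> V -> W) (G : nat -> U -> V) (n : nat) (x : U) : W :=
  \sum_(0 <= i < n.+1) F i (G (n - i)%N x).

Section Stabilization.
Variables (R : realType) (K : fieldType) (B B' : lmodType K).
Variable L : nat -> {linear B -> B'}.

Definition toeplitz (k : nat) (b : {ffun 'I_k -> B}) : {ffun 'I_k -> B'} :=
  [ffun i : 'I_k => \sum_(j < k | (i <= j)%N) L (j - i)%N (b j)].

(* Block vectors are written (b_(k-1), ..., b_0), so b_0 is the last entry. *)
Definition chain_lengths (b0 : B) : set nat :=
  [set k | exists2 k' : nat, k = k'.+1 &
     exists2 b : {ffun 'I_k'.+1 -> B}, b ord_max = b0 & toeplitz b = 0].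

(* Values in N u {oo}, embedded in the extended reals. *)
Definition rank (b0 : B) : \bar R :=
  if `[< L 0%N b0 = 0 >]
  then ereal_sup [set (k%:R : R)%:E | k in chain_lengths b0]
  else 0%E.

Definition stabilizes_at (k : nat) : Prop :=
  (forall b0 : B, (exists2 m : nat, (m <= k)%N & rank b0 = (m%:R)%:E)
                  \/ rank b0 = +oo%E)
  /\ exists b0 : B, rank b0 = (k%:R)%:E.

End Stabilization.

Section Recursion.
Variables (K : fieldType) (B B' : lmodType K).
Variable L : nat -> {linear B -> B'}.

(* Only the indices j >= 1 of S, Sb and 1 <= i <= j of E i j, M i j carry
   meaning.  Sb is the barred S; Rg is R. *)
Record is_recursion (N Nc : nat -> set B) (Rg Rc : nat -> set B')
    (Sb S : nat -> B -> B') (E M : nat -> nat -> B -> B) : Prop := {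
  rec_N0 : N 0%N = setT;
  rec_Nc0 : Nc 0%N = [set 0];
  rec_R0 : Rg 0%N = [set 0];
  rec_Rc0 : Rc 0%N = setT;
  rec_Sb1 : forall x, Sb 1%N x = L 0%N x;
  rec_S1 : forall x, S 1%N x = L 0%N x;
  rec_E11 : forall x, E 1%N 1%N x = x;
  rec_M11 : forall x, M 1%N 1%N x = x;
  rec_N : forall j, (1 <= j)%N -> N j = [set n | N j.-1 n /\ S j n = 0];
  rec_R : forall j, (1 <= j)%N -> Rg j = S j @` N j.-1;
  rec_Nc : forall j, (1 <= j)%N -> direct_sum (N j.-1) (Nc j) (N j);
  rec_Rc : forall j, (1 <= j)%N -> direct_sum (Rc j.-1) (Rg j) (Rc j);
  rec_Sb : forall j, (2 <= j)%N -> forall x,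
    Sb j x = \sum_(1 <= i < j) L i (M i j.-1 x);
  rec_S : forall j, (2 <= j)%N -> forall x,
    S j x = Sb j x - \sum_(1 <= i < j) dsum_proj i Rg (Rc i) i (Sb j x);
  rec_Ejj : forall j, (2 <= j)%N -> forall x, E j j x = x;
  rec_E : forall i j, (1 <= i < j)%N -> forall x,
    E i j x = - inv_on (Nc i) (S i)
                  (dsum_proj i Rg (Rc i) i
                     (\sum_(i.+1 <= nu < j.+1) Sb nu (E nu j x)));
  rec_M1 : forall j, (2 <= j)%N -> forall x, M 1%N j x = E 1%N j x;
  rec_M : forall i j, (2 <= i <= j)%N -> forall x,
    M i j x = \sum_(i <= nu < j.+1) M i.-1 nu.-1 (E nu j x)
}.

Definition phi (M : nat -> nat -> B -> B) (k i : nat) : B -> B :=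
  if i is 0%N then id else M k.+1 (k.+1 + i)%N.

(* The coefficient of eps^n in Delta(eps) = sum_(n <= k) eps^n S_(n+1) P_(n+1). *)
Definition Delta (N Nc : nat -> set B) (S : nat -> B -> B') (k n : nat)
    (x : B) : B' :=
  if (n <= k)%N then S n.+1 (dsum_proj k.+1 Nc (N k.+1) n.+1 x) else 0.

End Recursion.

(* Main.v *)
(** Write [Q_n] for the projection of [B'] onto [R_n^c] along [R_1 + ... + R_n],
    so that [S_j = Q_(j-1) Sb_j].  Two facts carry the proof.

    First, [sum_i L_i M_(p+i,j) = S_(j-p+1)] for [1 <= p <= j].  For [p = 1] the
    left side is [sum_nu Sb_nu E_(nu,j)], which the choice of the [E_(nu,j)]
    reduces to [Q_(j-1) Sb_j]; each increase of [p] only adds terms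
    [S_i E_(nu,j)] with [i < nu], and these vanish because [E_(nu,j)] takes its
    values in [N_nu^c], inside [N_i].

    Second, [N_j] is exactly the set of leading terms of chains of length [j].
    Stabilization at [k] therefore gives [N_j = N_(k+1)] for [j > k], hence
    [E_(i,j) = 0] for [k + 1 < i < j], and [M_(i,i+m)] does not depend on
    [i > k].  The first fact with [p = k + 1] is then the Cauchy product
    [L phi = S], and [psi] is read off from [S_m : N_m^c -> R_m] being
    bijective. *)

Require Import Defs.
From HB Require Import structures.
From mathcomp Require Import all_boot all_order all_algebra.
From mathcomp Require Import boolp classical_sets functions.
From mathcomp Require Import reals constructive_ereal ereal.
From mathcomp Require Import zify.

Set Implicit Arguments.
Unset Strict Implicit.
Unset Printing Implicit Defensive.

Import Order.TTheory GRing.Theory Num.Theory.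

Local Open Scope classical_set_scope.
Local Open Scope ring_scope.

(** * Linearity as a property of bare functions *)

Section LinearProp.
Variables (K : fieldType).

(** The recursion provides bare functions; bundling transfers the lemmas on linear maps to them, and
    finally turns the coefficients of [psi] into linear maps. *)
Lemma linear_pack (U V : lmodType K) (f : U -> V) :
  linear f -> {g : {linear U -> V} | g =1 f}.
Proof.
move=> lf.
pose l := GRing.isLinear.Build K U V *:%R f lf.
pose g : {linear U -> V} := HB.pack f l.
by exists g.
Qed.

Variables (U V : lmodType K) (f : U -> V).
Hypothesis lf : linear f.

Lemma linear_prop0 : f 0 = 0.
Proof. by have [g gf] := linear_pack lf; rewrite -gf linear0. Qed.

Lemma linear_propN x : f (- x) = - f x.
Proof. by have [g gf] := linear_pack lf; rewrite -!gf linearN. Qed.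

Lemma linear_propD x y : f (x + y) = f x + f y.
Proof. by have [g gf] := linear_pack lf; rewrite -!gf linearD. Qed.

Lemma linear_prop_sum (I : Type) (r : seq I) (Q : pred I) (F : I -> U) :
  f (\sum_(i <- r | Q i) F i) = \sum_(i <- r | Q i) f (F i).
Proof.
have [g gf] := linear_pack lf; rewrite -gf linear_sum.
by apply: eq_bigr => i _.
Qed.

End LinearProp.

Section LinearClosure.
Variables (K : fieldType) (U V W : lmodType K).

Lemma linear_prop_eq (f g : U -> V) : f =1 g -> linear g -> linear f.
Proof. by move=> fg lg a x y; rewrite !fg lg. Qed.

Lemma linear_prop_comp (f : V -> W) (g : U -> V) :
  linear f -> linear g -> linear (f \o g).
Proof. by move=> lf lg a x y; rewrite /= lg lf. Qed.

Lemma linear_prop_opp (f : U -> V) : linear f -> linear (fun x => - f x).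
Proof. by move=> lf a x y; rewrite lf opprD scalerN. Qed.

Lemma linear_prop_add (f g : U -> V) :
  linear f -> linear g -> linear (fun x => f x + g x).
Proof. by move=> lf lg a x y; rewrite lf lg scalerDr addrACA. Qed.

Lemma linear_prop_sum_fun (m n : nat) (F : nat -> U -> V) :
  (forall i, (m <= i < n)%N -> linear (F i)) ->
  linear (fun x => \sum_(m <= i < n) F i x).
Proof.
move=> lF a x y; rewrite scaler_sumr -big_split /=.
by apply: eq_big_nat => i /lF ->.
Qed.

End LinearClosure.

(** * Linear subspaces as sets *)

Section Subspaces.
Variables (K : fieldType) (V : lmodType K) (A : set V).
Hypothesis sA : submod_closed (mem A).

Lemma subspace0 : A 0.
Proof. by case: sA; rewrite inE. Qed.

Lemma subspace_lin a x y : A x -> A y -> A (a *: x + y).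
Proof.
by case: sA => _ h Ax Ay; have := h a x y; rewrite !inE; apply.
Qed.

Lemma subspaceD x y : A x -> A y -> A (x + y).
Proof. by move=> Ax Ay; rewrite -(scale1r x); exact: subspace_lin. Qed.

Lemma subspaceN x : A x -> A (- x).
Proof.
move=> Ax; rewrite -scaleN1r -(addr0 (_ *: _)).
by apply: subspace_lin => //; exact: subspace0.
Qed.

Lemma subspaceB x y : A x -> A y -> A (x - y).
Proof. by move=> Ax Ay; apply: subspaceD => //; exact: subspaceN. Qed.

End Subspaces.

(** * Decreasing flags of complements and their projections *)

Section Flag.
Variables (K : fieldType) (V : lmodType K) (A C : nat -> set V).
Hypothesis C0 : C 0%N = setT.
Hypothesis flagC :
  forall j, (1 <= j)%N -> direct_sum (C j.-1) (A j) (C j).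

Local Notation proj i := (dsum_proj i A (C i) i).

Lemma flag_subspace n : submod_closed (mem (C n)).
Proof.
case: n => [|n]; last by have [] := @flagC n.+1 isT.
by rewrite C0; split => [|a x y]; rewrite !inE.
Qed.

Lemma flag_step_subspace n : (1 <= n)%N -> submod_closed (mem (A n)).
Proof. by move=> /flagC[]. Qed.

Lemma flag_split n x : C n x -> exists a c, [/\ A n.+1 a, C n.+1 c & x = a + c].
Proof.
have [_ _ /= -> _] := @flagC n.+1 isT.
by move=> -[a Aa [c Cc <-]]; exists a, c.
Qed.

Lemma flag_sum_sub n a c : A n.+1 a -> C n.+1 c -> C n (a + c).
Proof.
move=> Aa Cc; have [_ _ /= -> _] := @flagC n.+1 isT.
by exists a => //; exists c.
Qed.

Lemma flagS n : C n.+1 `<=` C n.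
Proof.
move=> c Cc; rewrite -[c]add0r; apply: flag_sum_sub => //.
by apply: subspace0; apply: flag_step_subspace.
Qed.

Lemma flag_sub m n : (m <= n)%N -> C n `<=` C m.
Proof.
elim: n => [|n IH]; first by rewrite leqn0 => /eqP ->.
rewrite leq_eqVlt => /orP[/eqP -> //|]; rewrite ltnS => /IH h x /flagS.
exact: h.
Qed.

Lemma flag_step_sub m n : (m < n)%N -> A n `<=` C m.
Proof.
case: n => // n; rewrite ltnS => mn x Ax; apply: (flag_sub mn).
rewrite -[x]addr0; apply: flag_sum_sub => //.
by apply: subspace0; apply: flag_subspace.
Qed.

Lemma flag_split_uniq n a c a' c' : A n.+1 a -> C n.+1 c -> A n.+1 a' ->
  C n.+1 c' -> a + c = a' + c' -> a = a' /\ c = c'.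
Proof.
have [sA sC _ AC0] := @flagC n.+1 isT.
move=> Aa Cc Aa' Cc' e.
have e' : a - a' = c' - c.
  by apply/eqP; rewrite subr_eq addrAC -subr_eq opprK e addrC.
have : (A n.+1 `&` C n.+1) (a - a').
  split; first exact: subspaceB.
  by rewrite e'; exact: subspaceB.
rewrite AC0 /= => h; have := h; rewrite e' => /eqP.
by rewrite subr_eq0 => /eqP ->; move/eqP: h; rewrite subr_eq0 => /eqP.
Qed.

Lemma flag_decomp n x : exists (a : nat -> V) (c : V),
  [/\ forall m, (1 <= m <= n)%N -> A m (a m), C n c
    & x = \sum_(1 <= m < n.+1) a m + c].
Proof.
elim: n => [|n [a [c [Aa Cc ->]]]].
  exists (fun=> 0), x; split; first by case.
    by rewrite C0.
  by rewrite big_geq // add0r.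
have [b [d [Ab Cd ->]]] := flag_split Cc.
exists (fun m => if m == n.+1 then b else a m), d; split => //.
  move=> m /andP[m1]; case: eqP => [-> //|/eqP ne mn].
  by apply: Aa; rewrite m1 -ltnS ltn_neqAle ne mn.
rewrite [in RHS]big_nat_recr //= eqxx -!addrA; congr (_ + _).
by apply: eq_big_nat => m /andP[_ mn]; rewrite ltn_eqF.
Qed.

(** Induction on [n]: the last summand and the remainder together lie in [C n], so the shorter
    decompositions agree, and the final splitting is direct. *)
Lemma flag_decomp_uniq n (a a' : nat -> V) (c c' : V) :
  (forall m, (1 <= m <= n)%N -> A m (a m)) ->
  (forall m, (1 <= m <= n)%N -> A m (a' m)) -> C n c -> C n c' ->
  \sum_(1 <= m < n.+1) a m + c = \sum_(1 <= m < n.+1) a' m + c' ->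
  (forall m, (1 <= m <= n)%N -> a m = a' m) /\ c = c'.
Proof.
elim: n c c' => [|n IH] c c' Aa Aa' Cc Cc'.
  by rewrite !big_geq // !add0r => ->; split => // -[].
rewrite !(@big_nat_recr _ _ _ n.+1) //= -!addrA.
have An : A n.+1 (a n.+1) by apply: Aa; rewrite leqnn.
have An' : A n.+1 (a' n.+1) by apply: Aa'; rewrite leqnn.
move=> /IH[||||h /flag_split_uniq] //.
- by move=> m /andP[m1 mn]; apply: Aa; rewrite m1 leqW.
- by move=> m /andP[m1 mn]; apply: Aa'; rewrite m1 leqW.
- exact: flag_sum_sub.
- exact: flag_sum_sub.
move=> /(_ _ An Cc An' Cc')[e ->]; split => // m /andP[m1].
by rewrite leq_eqVlt => /orP[/eqP -> //|mn]; apply: h; rewrite m1.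
Qed.

Lemma flag_projE n i (a : nat -> V) (c : V) : (1 <= i <= n)%N ->
  (forall m, (1 <= m <= n)%N -> A m (a m)) -> C n c ->
  dsum_proj n A (C n) i (\sum_(1 <= m < n.+1) a m + c) = a i.
Proof.
move=> hi Aa Cc; apply: xget_unique; first by exists a, c.
move=> y [a' [c' [Aa' Cc' e ->]]].
by have [-> //] := flag_decomp_uniq Aa' Aa Cc' Cc (esym e).
Qed.

Lemma flag_sum_tail n i (a : nat -> V) (c : V) : (i <= n)%N ->
  (forall m, (1 <= m <= n)%N -> A m (a m)) -> C n c ->
  C i (\sum_(i.+1 <= m < n.+1) a m + c).
Proof.
elim: n c => [|n IH] c.
  by rewrite leqn0 => /eqP -> _ Cc; rewrite big_geq // add0r.
rewrite leq_eqVlt => /orP[/eqP -> _ Cc|]; first by rewrite big_geq // add0r.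
rewrite ltnS => ilen Aa Cc; rewrite big_nat_recr //= -addrA; apply: IH => //.
  by move=> m /andP[m1 mn]; apply: Aa; rewrite m1 leqW.
by apply: flag_sum_sub => //; apply: Aa; rewrite leqnn.
Qed.

(** The summands beyond the [i]-th, together with the remainder, lie in [C i], so truncating at
    level [i] keeps component [i]. This reconciles the projections in [Delta], taken at level [k+1],
    with those of the recursion. *)
Lemma flag_proj_level n i x : (1 <= i <= n)%N ->
  dsum_proj n A (C n) i x = proj i x.
Proof.
move=> /[dup] hi /andP[i1 ilen].
have [a [c [Aa Cc ->]]] := flag_decomp n x.
rewrite flag_projE // (@big_cat_nat _ _ _ i.+1) //= -addrA.
rewrite flag_projE //; first by rewrite i1 leqnn.
- by move=> m /andP[m1 mi]; apply: Aa; rewrite m1 (leq_trans mi).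
- exact: flag_sum_tail.
Qed.

(** The third clause is how projections are computed below: exhibiting one decomposition is
    enough. *)
Lemma flag_proj_decomp n x :
  [/\ forall m, (1 <= m <= n)%N -> A m (proj m x),
      C n (x - \sum_(1 <= m < n.+1) proj m x)
    & forall (a : nat -> V) (c : V),
      (forall m, (1 <= m <= n)%N -> A m (a m)) -> C n c ->
      x = \sum_(1 <= m < n.+1) a m + c ->
      forall m, (1 <= m <= n)%N -> proj m x = a m].
Proof.
have h : forall (a : nat -> V) (c : V),
      (forall m, (1 <= m <= n)%N -> A m (a m)) -> C n c ->
      x = \sum_(1 <= m < n.+1) a m + c ->
      forall m, (1 <= m <= n)%N -> proj m x = a m.
  move=> a c Aa Cc -> m hm.
  by rewrite -(flag_proj_level _ hm) flag_projE.
have [a [c [Aa Cc e]]] := flag_decomp n x.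
have ea := h _ _ Aa Cc e; split => //.
  by move=> m hm; rewrite ea //; exact: Aa.
rewrite (eq_big_nat _ _ (F2 := a)); last by move=> m; rewrite ltnS => /ea.
by rewrite [x in x - _]e addrC addKr.
Qed.

Lemma flag_proj_in i x : (1 <= i)%N -> A i (proj i x).
Proof.
by move=> i1; have [h _ _] := flag_proj_decomp i x; apply: h; rewrite i1 leqnn.
Qed.

Lemma flag_coproj_in n x : C n (x - \sum_(1 <= m < n.+1) proj m x).
Proof. by have [_ h _] := flag_proj_decomp n x. Qed.

Lemma flag_proj_linear i : (1 <= i)%N -> linear (proj i).
Proof.
move=> i1 a x y; have [_ _ h] := flag_proj_decomp i (a *: x + y).
apply: (h (fun m => a *: proj m x + proj m y)
  (a *: (x - \sum_(1 <= m < i.+1) proj m x) +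
   (y - \sum_(1 <= m < i.+1) proj m y))).
- move=> m /andP[m1 _].
  by apply: (subspace_lin (flag_step_subspace m1)); apply: flag_proj_in.
- by apply: (subspace_lin (flag_subspace i)); apply: flag_coproj_in.
- rewrite big_split /= -scaler_sumr scalerBr addrACA.
  by rewrite ![_ + (_ - _)]addrC !subrK.
- by rewrite i1 leqnn.
Qed.

Lemma flag_proj_tail i n x : (1 <= i <= n)%N -> C n x -> proj i x = 0.
Proof.
move=> hi Cx; have [_ _ h] := flag_proj_decomp n x.
apply: (h (fun=> 0) x) => //; last by rewrite big1 // add0r.
by move=> m /andP[m1 _]; apply: subspace0; apply: flag_step_subspace.
Qed.

Lemma flag_proj_step i n x : (1 <= i)%N -> (1 <= n)%N -> A n x ->
  proj i x = if i == n then x else 0.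
Proof.
move=> i1 n1 Ax.
case: (ltnP i n) => [lt_in|le_ni].
  rewrite ltn_eqF //; case: n lt_in n1 Ax => // n; rewrite ltnS => le_in _ Ax.
  by apply: (@flag_proj_tail i n); rewrite ?i1 //; apply: flag_step_sub Ax.
have [_ _ h] := flag_proj_decomp i x.
apply: (h (fun m => if m == n then x else 0) 0).
- move=> m /andP[m1 _]; case: eqP => [-> //|_].
  by apply: subspace0; apply: flag_step_subspace.
- by apply: subspace0; apply: flag_subspace.
- rewrite addr0 (@big_cat_nat _ _ _ n) //=; last by rewrite leqW.
  rewrite big_nat_cond big1 ?add0r; last first.
    by move=> m; rewrite andbT => /andP[_ mn]; rewrite ltn_eqF.
  rewrite big_ltn ?ltnS // eqxx big_nat_cond big1 ?addr0 //.
  by move=> m; rewrite andbT => /andP[mn _]; rewrite gtn_eqF.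
- by rewrite i1 leqnn.
Qed.

(** The projection onto [C n] along [A 1 + ... + A n]; for the flag [Rc] it is [Q_n]. *)
Definition flag_coproj n x := x - \sum_(1 <= m < n.+1) proj m x.

Lemma flag_coproj0 x : flag_coproj 0 x = x.
Proof. by rewrite /flag_coproj big_geq // subr0. Qed.

Lemma flag_coprojS n x : flag_coproj n.+1 x = flag_coproj n x - proj n.+1 x.
Proof. by rewrite /flag_coproj big_nat_recr //= opprD addrA. Qed.

Lemma flag_coproj_linear n : linear (flag_coproj n).
Proof.
apply: linear_prop_add; first by move=> a x y.
apply/linear_prop_opp/linear_prop_sum_fun => i /andP[i1 _].
exact: flag_proj_linear.
Qed.

Lemma flag_proj_coproj n x : proj n.+1 (flag_coproj n x) = proj n.+1 x.
Proof.
have lP := flag_proj_linear (ltn0Sn n).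
rewrite /flag_coproj (linear_propD lP) (linear_propN lP) (linear_prop_sum lP).
rewrite big_nat_cond big1 ?subr0 // => m; rewrite andbT => /andP[m1 mn].
rewrite (@flag_proj_step n.+1 m) //; last exact: flag_proj_in.
by rewrite gtn_eqF.
Qed.

End Flag.

(** Both sides run over the triangle [p + i <= nu <= j]. In [rec_toeplitz] this collects the terms
    with the same [E nu j]. *)
Lemma sum_triangle (V : nmodType) (p j : nat) (F : nat -> nat -> V) :
  (p <= j)%N ->
  \sum_(0 <= i < (j - p).+1) \sum_(p + i <= nu < j.+1) F i nu =
  \sum_(p <= nu < j.+1) \sum_(0 <= i < (nu - p).+1) F i nu.
Proof.
move=> pj.
transitivity (\sum_(0 <= i < (j - p).+1) 
    \sum_(p <= nu < j.+1) if (p + i <= nu)%N then F i nu else 0).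
  apply: eq_big_nat => i hi.
  rewrite [RHS](@big_cat_nat _ _ _ (p + i)) /=; [|lia|lia].
  rewrite [X in X + _]big_nat_cond [X in X + _]big1 ?add0r; last first.
    by move=> nu hnu; case: ifP => //; lia.
  by apply: eq_big_nat => nu hnu; case: ifP => //; lia.
rewrite exchange_big_nat /=; apply: eq_big_nat => nu hnu.
rewrite (@big_cat_nat _ _ _ (nu - p).+1) /=; [|lia|lia].
rewrite [X in _ + X]big_nat_cond [X in _ + X]big1 ?addr0; last first.
  by move=> i hi; case: ifP => //; lia.
by apply: eq_big_nat => i hi; case: ifP => //; lia.
Qed.

(** * The operators of the recursion and their Toeplitz identity *)

Section Recursion.
Variables (K : fieldType) (B B' : lmodType K).
Variable L : nat -> {linear B -> B'}.
Variables (N Nc : nat -> set B) (Rg Rc : nat -> set B').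
Variables (Sb S : nat -> B -> B') (E M : nat -> nat -> B -> B).
Hypothesis hrec : is_recursion L N Nc Rg Rc Sb S E M.

Local Notation N0 := (rec_N0 hrec).
Local Notation Rc0 := (rec_Rc0 hrec).
Local Notation flagN := (rec_Nc hrec).
Local Notation flagR := (rec_Rc hrec).

Local Notation P i := (dsum_proj i Rg (Rc i) i).
Local Notation Q := (flag_coproj Rg Rc).

Lemma rec_S_coproj j x : S j.+1 x = Q j (Sb j.+1 x).
Proof.
case: j => [|j]; last by rewrite (rec_S hrec).
by rewrite flag_coproj0 (rec_S1 hrec) (rec_Sb1 hrec).
Qed.

Lemma rec_S_in j x : Rc j (S j.+1 x).
Proof. by rewrite rec_S_coproj; exact: (flag_coproj_in Rc0 flagR). Qed.

Lemma rec_S_linear j : linear (Sb j.+1) -> linear (S j.+1).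
Proof.
move=> lSb; apply: (linear_prop_eq (rec_S_coproj j)).
exact: (linear_prop_comp (flag_coproj_linear Rc0 flagR j) lSb).
Qed.

Lemma rec_S_ker i j x : (1 <= i <= j)%N -> N j x -> S i x = 0.
Proof.
move=> /andP[i1 ij] /(flag_sub flagN ij).
by rewrite (rec_N hrec i1) => -[].
Qed.

Lemma rec_S_injective i x y : (1 <= i)%N -> linear (S i) ->
  Nc i x -> Nc i y -> S i x = S i y -> x = y.
Proof.
move=> i1 lS Nx Ny e; have [sNc _ _ NcN] := flagN i1.
have : (Nc i `&` N i) (x - y).
  split; first exact: subspaceB.
  rewrite (rec_N hrec i1); split.
    case: i i1 Nx Ny {lS e sNc NcN} => // i _ Nx Ny.
    apply: (subspaceB (flag_subspace N0 flagN i));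
      exact: (@flag_step_sub _ _ _ _ N0 flagN i i.+1).
  by rewrite (linear_propD lS) (linear_propN lS) e subrr.
by rewrite NcN => /eqP; rewrite subr_eq0 => /eqP.
Qed.

Lemma rec_image_complement i : (1 <= i)%N -> linear (S i) ->
  S i @` Nc i = Rg i.
Proof.
move=> i1 lS; rewrite (rec_R hrec i1).
case: i i1 lS => // i _ lS /=; apply/seteqP; split => [y [x Nx <-]|y [x Nx <-]].
  by exists x => //; exact: (@flag_step_sub _ _ _ _ N0 flagN i i.+1).
have [a [c [Na Nc' ->]]] := flag_split flagN Nx.
exists a => //; rewrite (linear_propD lS) (@rec_S_ker i.+1 i.+1 c) ?addr0 //.
by rewrite leqnn.
Qed.

Lemma rec_inv i y : (1 <= i)%N -> linear (S i) -> Rg i y ->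
  Nc i (inv_on (Nc i) (S i) y) /\ S i (inv_on (Nc i) (S i) y) = y.
Proof.
move=> i1 lS; rewrite -rec_image_complement // => -[x Nx <-].
exact: (@xgetI _ 0 [set z | Nc i z /\ S i z = S i x] x).
Qed.

Lemma rec_invK i x : (1 <= i)%N -> linear (S i) -> Nc i x ->
  inv_on (Nc i) (S i) (S i x) = x.
Proof.
move=> i1 lS Nx; have [|Ny e] := @rec_inv i (S i x) i1 lS.
  by rewrite -rec_image_complement //; exists x.
by apply: rec_S_injective e.
Qed.

(** [inv_on] is a chosen preimage, meaningful only on [Rg i]; precomposing with [P i] gives a map
    that is linear on all of [B']. *)
Lemma rec_inv_proj_linear i : (1 <= i)%N -> linear (S i) ->
  linear (inv_on (Nc i) (S i) \o P i).
Proof.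
move=> i1 lS a x y; rewrite /= (flag_proj_linear Rc0 flagR i1).
have hin z : Rg i (P i z) by exact: (flag_proj_in Rc0 flagR).
have [Nx ex] := rec_inv i1 lS (hin x).
have [Ny ey] := rec_inv i1 lS (hin y).
rewrite -[in LHS]ex -[in LHS]ey -lS rec_invK //.
have [sNc _ _ _] := flagN i1; exact: subspace_lin.
Qed.

Lemma rec_E_diag j x : (1 <= j)%N -> E j j x = x.
Proof.
by case: j => // -[|j] _; [rewrite (rec_E11 hrec)|rewrite (rec_Ejj hrec)].
Qed.

Lemma rec_M_row1 j x : (1 <= j)%N -> M 1%N j x = E 1%N j x.
Proof.
case: j => // -[|j] _; last by rewrite (rec_M1 hrec).
by rewrite (rec_M11 hrec) rec_E_diag.
Qed.

(** Strong induction on the column [j], because [Sb j] and [M i j] take entries of [M] from earlier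
    columns only; within a column the [E i j] follow by descending [i]. *)
Lemma rec_linear j : (1 <= j)%N -> linear (Sb j) /\
  forall i, (1 <= i <= j)%N -> linear (E i j) /\ linear (M i j).
Proof.
elim/ltn_ind: j => j IH j1.
have lSb : linear (Sb j).
  case: j j1 IH => // -[|j] _ IH.
    by apply: (linear_prop_eq (rec_Sb1 hrec)); exact: linearP.
  apply: (linear_prop_eq (rec_Sb hrec _)) => //.
  apply: linear_prop_sum_fun => i /andP[i1 ij].
  apply: (linear_prop_comp (linearP (L i))).
  have [//|//|_ h] := IH j.+1.
  by have [] := h i; rewrite ?i1.
have lSb' nu : (1 <= nu <= j)%N -> linear (Sb nu).
  move=> /andP[nu1]; rewrite leq_eqVlt => /orP[/eqP -> //|nuj].
  by have [] := IH nu.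
have lE i : (1 <= i <= j)%N -> linear (E i j).
  move=> /andP[i1 ij]; move: {2}(j - i)%N (leqnn (j - i)) => d.
  elim: d i i1 ij => [|d IHd] i i1 ij hd.
    have -> : i = j by lia.
    by apply: (linear_prop_eq (fun x => rec_E_diag x j1)).
  move: ij; rewrite leq_eqVlt => /orP[/eqP ->|ij].
    by apply: (linear_prop_eq (fun x => rec_E_diag x j1)).
  apply: (linear_prop_eq (rec_E hrec _)); first by rewrite i1.
  apply: linear_prop_opp.
  have lS : linear (S i).
    by case: i i1 ij {hd} => // i _ ij; apply/rec_S_linear/lSb'; lia.
  apply: (linear_prop_comp (rec_inv_proj_linear i1 lS)).
  apply: linear_prop_sum_fun => nu hnu.
  apply: linear_prop_comp; first by apply: lSb'; lia.
  by apply: IHd; lia.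
split => // i hi; split; first exact: lE.
case: i hi => // -[_|i hi].
  by apply: (linear_prop_eq (fun x => rec_M_row1 x j1)); apply: lE; rewrite j1.
apply: (linear_prop_eq (@rec_M _ _ _ _ _ _ _ _ _ _ _ _ hrec i.+2 j hi)).
apply: linear_prop_sum_fun => nu hnu.
apply: linear_prop_comp; last by apply: lE; lia.
have [||_ h] := IH nu.-1; [lia|lia|].
by have [] := h i.+1; first lia.
Qed.

Lemma rec_Sb_lin j : (1 <= j)%N -> linear (Sb j).
Proof. by move=> /rec_linear[]. Qed.

Lemma rec_S_lin j : (1 <= j)%N -> linear (S j).
Proof. by case: j => // j _; apply/rec_S_linear/rec_Sb_lin. Qed.

Lemma rec_M_lin i j : (1 <= i <= j)%N -> linear (M i j).
Proof.
move=> hij; have [|_ h] := @rec_linear j; first by lia.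
by have [] := h i hij.
Qed.

Lemma rec_E_in i j x : (1 <= i < j)%N -> Nc i (E i j x).
Proof.
move=> /[dup] hij /andP[i1 _]; rewrite (rec_E hrec hij).
have [sNc _ _ _] := flagN i1; apply: subspaceN => //.
apply: (rec_inv i1 (rec_S_lin i1) _).1.
exact: (flag_proj_in Rc0 flagR).
Qed.

Lemma rec_S_E i j x : (1 <= i < j)%N ->
  S i (E i j x) = - P i (\sum_(i.+1 <= nu < j.+1) Sb nu (E nu j x)).
Proof.
move=> /[dup] hij /andP[i1 _]; rewrite (rec_E hrec hij).
rewrite (linear_propN (rec_S_lin i1)) (rec_inv i1 (rec_S_lin i1) _).2 //.
exact: (flag_proj_in Rc0 flagR).
Qed.

Lemma rec_M_diag j x : (1 <= j)%N -> M j j x = x.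
Proof.
elim: j => // -[|j] IH _; first by rewrite (rec_M11 hrec).
by rewrite (rec_M hrec) ?leqnn //= big_nat1 /= rec_E_diag // IH.
Qed.

(* Each step absorbs one more E i j: applying Q (i - 1) to its term yields
   S i (E i j), which cancels the R i component of the remaining sum. *)
Lemma rec_sum_Sb_E_coproj i j x : (i < j)%N ->
  \sum_(1 <= nu < j.+1) Sb nu (E nu j x) =
  Q i (\sum_(i.+1 <= nu < j.+1) Sb nu (E nu j x)).
Proof.
elim: i => [_|i IH ij]; first by rewrite flag_coproj0.
rewrite IH; last exact: ltnW.
rewrite [in LHS]big_ltn; last by rewrite ltnS ltnW.
rewrite (linear_propD (flag_coproj_linear Rc0 flagR i)) -rec_S_coproj.
by rewrite rec_S_E // flag_coprojS addrC.
Qed.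

Lemma rec_sum_Sb_E j x : (1 <= j)%N ->
  \sum_(1 <= nu < j.+1) Sb nu (E nu j x) = S j x.
Proof.
case: j => // j _; rewrite (@rec_sum_Sb_E_coproj j) // big_nat1.
by rewrite rec_E_diag // rec_S_coproj.
Qed.

Lemma rec_toeplitz p j x : (1 <= p <= j)%N ->
  \sum_(0 <= i < (j - p).+1) L i (M (p + i)%N j x) = S (j - p).+1 x.
Proof.
elim: p j x => // p IH j x hp.
(* Case [p = 1]: expanding [M i j] for [i >= 2] and collecting by [nu] rebuilds [Sb nu], which gives
   the sum of [rec_sum_Sb_E]. *)
case: p IH hp => [|p] IH hp.
  have ej : (j - 1).+1 = j by lia.
  rewrite ej -rec_sum_Sb_E {ej}; last by lia.
  rewrite [RHS]big_ltn; last by lia.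
  have j1 : (0 < j)%N by lia.
  rewrite [LHS]big_ltn // addn0 rec_M_row1 // (rec_Sb1 hrec).
  congr (_ + _).
  transitivity (\sum_(1 <= i < j)
    \sum_(i.+1 <= nu < j.+1) L i (M i nu.-1 (E nu j x))).
    apply: eq_big_nat => i hi; rewrite add1n (rec_M hrec); last by lia.
    by rewrite linear_sum.
  case: j {hp IH j1} => [|[|j]]; [by rewrite !big_geq|by rewrite !big_geq|].
  have := @sum_triangle B' 2 j.+2
    (fun i nu => L i.+1 (M i.+1 nu.-1 (E nu j.+2 x))) isT.
  have -> : ((j.+2 - 2).+1 = j.+1)%N by lia.
  move=> tri; rewrite [LHS]big_add1 /=; etransitivity; first exact: tri.
  apply: eq_big_nat => nu hnu; rewrite (rec_Sb hrec); last by lia.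
  rewrite [RHS]big_add1; apply: congr_big_nat => //; lia.
(* Expanding [M] and collecting by [nu] turns each inner sum into the induction hypothesis for
   column [nu - 1], that is, [S (nu - p - 1)] at [E nu j x]; the term [nu = j] is the claim and the
   others vanish. *)
rewrite (eq_big_nat _ _ (F2 := fun i => \sum_(p.+2 + i <= nu < j.+1)
    L i (M (p.+1 + i)%N nu.-1 (E nu j x)))); last first.
  by move=> i hi; rewrite (rec_M hrec) ?linear_sum //; lia.
rewrite sum_triangle; last by lia.
rewrite big_nat_recr /=; last by lia.
rewrite big_nat_cond big1 ?add0r.
  have := IH j.-1 x; rewrite rec_E_diag; last by lia.
  have -> : (j.-1 - p.+1 = j - p.+2)%N by lia.
  by apply; lia.
move=> nu; rewrite andbT => hnu.
have := IH nu.-1 (E nu j x).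
have -> : (nu.-1 - p.+1 = nu - p.+2)%N by lia.
move=> ->; last by lia.
apply: (@rec_S_ker _ nu.-1); first by lia.
apply: (@flag_step_sub _ _ _ _ N0 flagN _ nu); first by lia.
by apply: rec_E_in; lia.
Qed.

(** * Chains, and [N j] as the set of their leading terms *)

(** A chain of length [j] is kept as a total sequence with [residual c m = 0] for [m < j]; only
    [c 0, ..., c m] enter [residual c m]. *)
Definition residual (c : nat -> B) (m : nat) : B' :=
  \sum_(0 <= i < m.+1) L i (c (m - i)%N).

(* The chain c of an element c 0 of N j is compared with the canonical chain
   m |-> M (j - m) j (c 0): their difference, shifted by one, is a shorter
   chain. *)
Lemma residual_obstruction j (c : nat -> B) :
  (forall m, (m < j)%N -> residual c m = 0) ->
  N j (c 0%N) /\ Q j (residual c j) = S j.+1 (c 0%N).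
Proof.
elim: j c => [|j IH] c hc.
  rewrite N0 /residual big_nat1 subn0 flag_coproj0 (rec_S1 hrec).
  by split.
have [Nj ej] := IH c (fun m mj => hc m (ltnW mj)).
have NSj : N j.+1 (c 0%N).
  rewrite (rec_N hrec) //; split => //; rewrite -ej hc //.
  exact: (linear_prop0 (flag_coproj_linear Rc0 flagR j)).
split => //.
(* [M 0 _] carries no meaning, hence the cut-off at [m = j]; with the term at [m = j+1] zero,
   [residual b j.+1] is exactly the sum defining [Sb j.+2]. *)
pose b m := if (m <= j)%N then M (j.+1 - m)%N j.+1 (c 0%N) else 0.
pose d m := c m.+1 - b m.+1.
have b0 : b 0%N = c 0%N by rewrite /b /= subn0 rec_M_diag.
have resb m : (m <= j)%N -> residual b m = S m.+1 (c 0%N).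
  move=> mj; have hp : (1 <= j.+1 - m <= j.+1)%N by lia.
  have := @rec_toeplitz (j.+1 - m) j.+1 (c 0%N) hp.
  have -> : (j.+1 - (j.+1 - m) = m)%N by lia.
  move=> <-; apply: eq_big_nat => i hi; rewrite /b.
  case: ifP => h; last by lia.
  by congr (L i (M _ _ _)); lia.
have resbj : residual b j.+1 = Sb j.+2 (c 0%N).
  rewrite (rec_Sb hrec) // /residual big_ltn //= {1}/b subn0 ltnn linear0 add0r.
  apply: eq_big_nat => i hi; rewrite /b.
  case: ifP => h; last by lia.
  by congr (L i (M _ _ _)); lia.
have resd m : residual d m = residual c m.+1 - residual b m.+1.
  rewrite /residual !(@big_nat_recr _ _ _ m.+1) //= subnn b0.
  rewrite opprD addrACA subrr addr0 -sumrB; apply: eq_big_nat => i hi.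
  by rewrite /d linearB subSn //; lia.
(* For [m < j] the residuals of [c] and [b] both vanish at [m+1]: that of [b] is [S m.+2 (c 0)],
   with [c 0] in [N j.+1]. *)
have [Nd ed] : N j (d 0%N) /\ Q j (residual d j) = S j.+1 (d 0%N).
  apply: IH => m mj; rewrite resd hc // resb // sub0r.
  by rewrite (@rec_S_ker _ j.+1) ?oppr0 //; lia.
have -> : residual c j.+1 = residual d j + Sb j.+2 (c 0%N).
  by rewrite resd resbj subrK.
rewrite (linear_propD (flag_coproj_linear Rc0 flagR j.+1)) -rec_S_coproj.
suff -> : Q j.+1 (residual d j) = 0 by rewrite add0r.
(* [Q j] sends the residual of [d] to [S j.+1 (d 0)], which lies in [Rg j.+1] because [d 0] is in
   [N j]; the further projection in [Q j.+1] removes it. *)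
rewrite flag_coprojS ed.
have RS : Rg j.+1 (S j.+1 (d 0%N)) by rewrite (rec_R hrec) //; exists (d 0%N).
rewrite -(flag_proj_coproj Rc0 flagR) ed.
by rewrite (@flag_proj_step _ _ _ _ Rc0 flagR j.+1 j.+1) // eqxx subrr.
Qed.

(** The canonical chain has residuals [S m.+1 x], by [rec_toeplitz] with [p = j - m], and these
    vanish on [N j]. The converse is [residual_obstruction]. *)
Lemma rec_N_chain j x : N j x <-> exists2 c : nat -> B, c 0%N = x &
  forall m, (m < j)%N -> residual c m = 0.
Proof.
split=> [Nx|[c <- /residual_obstruction[]] //].
case: j Nx => [|j] Nx; first by exists (fun=> x).
exists (fun m => M (j.+1 - m)%N j.+1 x); first by rewrite subn0 rec_M_diag.
move=> m mj; have := @rec_toeplitz (j.+1 - m) j.+1 x.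
have -> : (j.+1 - (j.+1 - m) = m)%N by lia.
rewrite (@rec_S_ker m.+1 j.+1) // => <-; last by lia.
by apply: eq_big_nat => i hi; congr (L i (M _ _ _)); lia.
Qed.

(** Block vectors list [c 0] last, hence the reversed order [q - i] of row [i]. *)
Lemma toeplitz_residual q (c : nat -> B) (i : 'I_q.+1) :
  toeplitz L [ffun j : 'I_q.+1 => c (q - j)%N] i = residual c (q - i)%N.
Proof.
rewrite ffunE; under eq_bigr do rewrite ffunE.
rewrite -(big_mkord (fun j => (i <= j)%N) (fun j => L (j - i)%N (c (q - j)%N))).
have iq : (i < q.+1)%N := ltn_ord i.
rewrite (@big_cat_nat _ _ _ i) //=; last exact: ltnW.
rewrite [X in X + _]big_nat_cond [X in X + _]big1 ?add0r; last first.
  by move=> j; case: leqP => //; lia.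
rewrite -{1}[nat_of_ord i]add0n big_addn subSn //.
rewrite /residual big_mkcond; apply: eq_big_nat => j hj.
by rewrite leq_addl addnK; congr (L _ (c _)); lia.
Qed.

Lemma chain_lengthsP (x : B) q : chain_lengths L x q.+1 <->
  exists2 c : nat -> B, c 0%N = x &
    forall m, (m < q.+1)%N -> residual c m = 0.
Proof.
split=> [[_ [<-] [b <- tb]]|[c <- hc]].
  pose c m := b (inord (q - m)).
  have eb : b = [ffun j : 'I_q.+1 => c (q - j)%N].
    apply/ffunP => j; rewrite ffunE /c subKn ?inord_val //.
    by rewrite -ltnS ltn_ord.
  exists c.
    by rewrite /c subn0; congr (b _); apply/val_inj; rewrite /= inordK.
  move=> m mq; have hq : (q - m < q.+1)%N by lia.
  have := toeplitz_residual c (Ordinal hq).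
  by rewrite -eb tb ffunE /= subKn.
exists q => //; exists [ffun j : 'I_q.+1 => c (q - j)%N].
  by rewrite ffunE subnn.
apply/ffunP => i; rewrite toeplitz_residual hc ?ffunE //.
by rewrite ltnS leq_subr.
Qed.

(** * Consequences of stabilization at [k] *)

Section Stable.
Variables (R : realType) (k : nat).
Hypothesis hk : stabilizes_at R L k.

(** A point of [N k.+1] starts a chain of length [k+1], so its rank exceeds [k] and must be
    infinite; arbitrarily long chains then put it in every [N j]. *)
Lemma rec_N_stable j : N k.+1 `<=` N j.
Proof.
move=> x Nx.
have L0x : L 0%N x = 0.
  by rewrite -(rec_S1 hrec) (@rec_S_ker 1 k.+1).
have := (rec_N_chain k.+1 x).1 Nx => /chain_lengthsP ck.
have := hk.1 x; rewrite /rank; case: asboolP => // _ [[m mk e]|e].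
  have : ((k.+1%:R : R)%:E <= m%:R%:E)%E.
    by rewrite -e; apply: ereal_sup_ubound; exists k.+1.
  by rewrite lee_fin ler_nat; lia.
(* An infinite supremum only says that the lengths are unbounded: a chain of length at least [j] is
   found by contradiction and then truncated. *)
have [q [hq jq]] : exists q, chain_lengths L x q /\ (j <= q)%N.
  apply: contrapT => /forallNP h.
  have : (+oo <= (j%:R : R)%:E)%E.
    rewrite -e; apply: ge_ereal_sup => _ [q hq <-]; rewrite lee_fin ler_nat.
    have := h q; case: leqP => [jq []|]; first by split.
    by move=> /ltnW.
  by rewrite leye_eq.
case: q hq jq => [[] //|q] /chain_lengthsP[c c0 hc] jq.
by apply/rec_N_chain; exists c => // m mj; apply: hc; lia.
Qed.

Lemma rec_S_vanish i x : (1 <= i)%N -> N k.+1 x -> S i x = 0.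
Proof. by move=> i1 /(@rec_N_stable i); apply: rec_S_ker; rewrite i1 /=. Qed.

(** The value lies in [Nc i], inside [N k.+1] and hence inside [N i], which meets [Nc i] only in
    0. *)
Lemma rec_E_vanish i j x : (k.+1 < i < j)%N -> E i j x = 0.
Proof.
move=> hij; have [|_ _ _ NcN] := @flagN i; first by lia.
have NE : Nc i (E i j x) by apply: rec_E_in; lia.
have : (Nc i `&` N i) (E i j x).
  split => //; apply: rec_N_stable.
  by apply: (@flag_step_sub _ _ _ _ N0 flagN _ i) => //; lia.
by rewrite NcN.
Qed.

(** In a row beyond [k+1] only the last term, [nu = j], of the recursion for [M i j] survives; as
    [E j j] is the identity, [M] is constant along diagonals. *)
Lemma rec_M_stable i m x : (k < i)%N ->
  M i (i + m)%N x = M k.+1 (k.+1 + m)%N x.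
Proof.
elim: i => // i IH; rewrite ltnS leq_eqVlt => /orP[/eqP <- //|ki].
rewrite (rec_M hrec); last by lia.
rewrite big_nat_recr /=; last by lia.
rewrite big_nat_cond big1 ?add0r => [|nu]; last first.
  rewrite andbT => hnu; rewrite rec_E_vanish; last by lia.
  by apply: linear_prop0; apply: rec_M_lin; lia.
by rewrite rec_E_diag //; apply: IH.
Qed.

Lemma phiE m x : phi M k m x = M k.+1 (k.+1 + m)%N x.
Proof. by case: m => //=; rewrite addn0 rec_M_diag. Qed.

Lemma cauchy_phi n x : cauchy_prod L (phi M k) n x = S n.+1 x.
Proof.
have := @rec_toeplitz k.+1 (k.+1 + n) x.
rewrite addKn => <-; last by lia.
apply: eq_big_nat => i hi; rewrite phiE.
(* Moving along the diagonal replaces [M (k+1) (k+1+n-i)] by [M (k+1+i) (k+1+n)], an entry of the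
   single column that [rec_toeplitz] sums. *)
rewrite -(@rec_M_stable (k.+1 + i)); last by lia.
by congr (L i (M _ _ x)); lia.
Qed.

(* The coefficients of psi: the l-th one carries S_m x to S_(l + m) x for x in
   N_m^c, and vanishes on R_(k+1)^c when l > 0. *)
Definition quotient_coef (l : nat) (y : B') : B' :=
  if l is 0%N then y else
  \sum_(1 <= m < k.+2) S (l + m)%N (inv_on (Nc m) (S m) (P m y)).

Lemma quotient_coef_linear l : linear (quotient_coef l).
Proof.
case: l => [a x y //|l]; apply: linear_prop_sum_fun => m /andP[m1 _].
apply: linear_prop_comp; first by apply: rec_S_lin; lia.
by apply: (rec_inv_proj_linear m1); apply: rec_S_lin.
Qed.

(** For [l > 0]: [S m x] lies in [Rg m], so only the [m]-th projection is nonzero, and the inverse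
    returns [x]. *)
Lemma quotient_coefE l m x : (1 <= m <= k.+1)%N -> Nc m x ->
  quotient_coef l (S m x) = S (l + m)%N x.
Proof.
move=> hm Nx; have m1 : (1 <= m)%N by lia.
case: l => [//|l]; rewrite /quotient_coef.
have RS : Rg m (S m x).
  by rewrite -(rec_image_complement m1 (rec_S_lin m1)); exists x.
rewrite (eq_big_nat _ _
  (F2 := fun i => if i == m then S (l.+1 + m)%N x else 0)).
  by rewrite -big_mkcond big_nat1_eq ltnS hm.
move=> i /andP[i1 _]; rewrite (flag_proj_step Rc0 flagR i1 m1 RS).
case: eqP => [->|_]; first by rewrite rec_invK //; exact: rec_S_lin.
have lS : linear (S i) by exact: rec_S_lin.
have Nc0 : Nc i 0 by have [sNc _ _ _] := flagN i1; exact: subspace0.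
have -> : inv_on (Nc i) (S i) 0 = 0.
  by rewrite -[X in inv_on _ _ X](linear_prop0 lS) rec_invK.
by apply: linear_prop0; apply: rec_S_lin; lia.
Qed.

Lemma cauchy_quotient n x :
  cauchy_prod quotient_coef (Delta N Nc S k) n x = S n.+1 x.
Proof.
(* Reversing the sum makes its index that of [Delta], so each term is [S n.+1] on one component of
   [x]. *)
rewrite /cauchy_prod big_nat_rev /= add0n.
rewrite (eq_big_nat _ _ (F2 := fun m => if (m < k.+1)%N then
  S n.+1 (dsum_proj m.+1 Nc (N m.+1) m.+1 x) else 0)); last first.
  move=> m hm; rewrite /Delta subSS subKn; last by lia.
  rewrite ltnS; case: leqP => mk; last first.
    exact: (linear_prop0 (quotient_coef_linear _)).
  rewrite (flag_proj_level N0 flagN) // quotient_coefE //.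
  - by congr (S _ _); lia.
  - exact: (flag_proj_in N0 flagN).
have lS : linear (S n.+1) by exact: rec_S_lin.
(* [Delta] stops at [eps^k] and the product at [eps^n], so the projections onto [Nc 1, ..., Nc q.+1]
   remain. *)
set q := minn n k.
have -> : \sum_(0 <= m < n.+1) (if (m < k.+1)%N then
    S n.+1 (dsum_proj m.+1 Nc (N m.+1) m.+1 x) else 0) =
    S n.+1 (\sum_(1 <= m < q.+2) dsum_proj m Nc (N m) m x).
  rewrite (linear_prop_sum lS) big_add1 /=.
  rewrite (@big_cat_nat _ _ _ q.+1) //=; last by lia.
  rewrite [X in _ + X]big_nat_cond [X in _ + X]big1 ?addr0; last first.
    by move=> m hm; case: ifP => //; lia.
  by apply: eq_big_nat => m hm; case: ifP => //; lia.
have := flag_coproj_in N0 flagN q.+1 x.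
set y := \sum_(1 <= m < q.+2) _ => Nxy.
apply/esym/eqP; rewrite -subr_eq0 -(linear_propN lS) -(linear_propD lS).
(* The rest of [x] lies in [N q.+1], which [S n.+1] kills: for [n <= k] this is [N n.+1], otherwise
   it is [N k.+1] and stabilization applies. *)
case: (leqP n k) => nk.
  have eq : q = n by lia.
  by rewrite (@rec_S_ker n.+1 n.+1) // ?leqnn // -eq.
have eq : q = k by lia.
by rewrite rec_S_vanish // -eq.
Qed.

End Stable.

End Recursion.

Theorem theorem2 (R : realType) (K : fieldType) (hK : real_or_complex R K)
    (B B' : lmodType K) (L : nat -> {linear B -> B'})
    (hL : exists (i : nat) (x : B), L i x <> 0)
    (k : nat) (hk : stabilizes_at R L k)
    (N Nc : nat -> set B) (Rg Rc : nat -> set B')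
    (Sb S : nat -> B -> B') (E M : nat -> nat -> B -> B)
    (hrec : is_recursion L N Nc Rg Rc Sb S E M) :
  [/\ forall i : nat, linear (phi M k i),
      forall n : nat, cauchy_prod L (phi M k) n =1 S n.+1,
      forall i : nat, (1 <= i <= k.+1)%N ->
        [/\ S i @` set_sum i Nc `<=` Rc i.-1,
            S i @` Nc i = Rg i & S i @` N i = [set 0]],
      forall l : nat, (2 <= l)%N ->
        range (S (k + l)%N) `<=` Rc k.+1
        /\ S (k + l)%N @` N k.+1 = [set 0]
    & forall i : nat, (1 <= i)%N -> S i @` N k.+1 = [set 0]]
  /\ (exists psi : nat -> {linear B' -> B'},
        (forall y : B', psi 0%N y = y) /\
        forall n : nat,
          cauchy_prod L (phi M k) n
          =1 cauchy_prod psi (Delta N Nc S k) n).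
Proof.
have image0 i j : (1 <= i)%N -> (forall x, N j x -> S i x = 0) ->
    S i @` N j = [set 0].
  move=> i1 h; apply/seteqP; split=> [_ [x /h -> <-] //|_ ->].
  have N0 := subspace0 (flag_subspace (rec_N0 hrec) (rec_Nc hrec) j).
  by exists 0 => //; exact: h.
have vanish i : (1 <= i)%N -> S i @` N k.+1 = [set 0].
  by move=> i1; apply: image0 => // x; exact: (rec_S_vanish hrec hk).
split; last first.
  pose psi l := sval (linear_pack (quotient_coef_linear hrec k l)).
  have psiE l y : psi l y = quotient_coef Nc Rg Rc S k l y.
    by rewrite /psi; case: linear_pack.
  exists psi; split=> [y|n x]; first by rewrite psiE.
  rewrite (cauchy_phi hrec hk) -(cauchy_quotient hrec hk).
  by apply: eq_big_nat => i _; rewrite psiE.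
split=> //.
- move=> i; apply: (linear_prop_eq (phiE hrec k i)).
  by apply: (rec_M_lin hrec); rewrite leq_addr.
- by move=> n x; exact: (cauchy_phi hrec hk).
- move=> i /andP[i1 _]; split.
  + case: i i1 => // i _ _ [x _ <-]; exact: (rec_S_in hrec).
  + exact: (rec_image_complement hrec i1 (rec_S_lin hrec i1)).
  + by apply: image0 => // x; apply: (rec_S_ker hrec); rewrite i1 leqnn.
- move=> l l2; split; last by apply: vanish; lia.
  move=> _ [x _ <-].
  (* [S (k + l)] maps into [Rc (k + l - 1)], and [k + l - 1 >= k + 1] because [l >= 2]. *)
  have -> : (k + l = (k + l.-1).+1)%N by lia.
  apply: (flag_sub (rec_Rc hrec) _ (rec_S_in hrec _ x)); lia.
Qed.
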